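(* In a sequence list $S_i$ of processed related edges, let $\epsilon$ be the number of items in a maximal run of consecutive items having the same nonzero tag. Then $2\le\epsilon\le 3$.
   Context: Given a circular-arc polygon (boundary consisting of circular arcs and possibly line segments, traversed counterclockwise) and a set of its edges called related edges, the processed related edges are obtained by replacing each non-x-monotone arc (an arc met twice by some vertical line) by its sub-arcs cut by the horizontal line through its circle's center, keeping other edges. The sequence list $S_i$ lists the processed related edges in counterclockwise order; each item carries a tag: $0$ if it is not a piece of a decomposed arc, and otherwise $1$ for pieces of the 1st, 3rd, 5th, … decomposed non-x-monotone arc (in list order) and $2$ for pieces of the 2nd, 4th, … one. *)

(* Defs.v *)
From Coquelicot Require Import Coquelicot.
From Stdlib Require Import Reals List Sorted Arith.
Import ListNotations.
Open Scope R_scope.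

Definition point : Type := (R * R)%type.

(** The sweep is signed: positive for an arc traversed counterclockwise around
    its own center, negative for one traversed clockwise.  Both kinds occur on
    a polygon boundary (bulging outwards, resp. inwards). *)
Record arc : Type := Arc_of {
  center : point;
  radius : R;
  start_angle : R;
  sweep : R
}.

Definition arc_point (A : arc) (t : R) : point :=
  (fst (center A) + radius A * cos (start_angle A + t * sweep A),
   snd (center A) + radius A * sin (start_angle A + t * sweep A)).

Definition on_arc (A : arc) (P : point) : Prop :=
  exists t, 0 <= t <= 1 /\ arc_point A t = P.

(** A sweep of absolute value [2 * PI] is a whole circle with one marked
    point; it can only occur as the single edge of a disc. *)
Definition wf_arc (A : arc) : Prop :=
  0 < radius A /\ 0 < Rabs (sweep A) <= 2 * PI.

Inductive edge : Type :=
| Seg (p q : point)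
| Arc (A : arc).

Definition edge_point (e : edge) (t : R) : point :=
  match e with
  | Seg p q => (fst p + t * (fst q - fst p), snd p + t * (snd q - snd p))
  | Arc A => arc_point A t
  end.

Definition wf_edge (e : edge) : Prop :=
  match e with
  | Seg p q => p <> q
  | Arc A => wf_arc A
  end.

(** The contribution of [e] to the area enclosed by a closed curve, by Green's
    formula: half the line integral of [x dy - y dx]. *)
Definition edge_area (e : edge) : R :=
  / 2 * RInt (fun t =>
    fst (edge_point e t) * Derive (fun u => snd (edge_point e u)) t
    - snd (edge_point e t) * Derive (fun u => fst (edge_point e u)) t) 0 1.

Definition signed_area (es : list edge) : R :=
  fold_right Rplus 0 (map edge_area es).

(** The edges are listed in boundary order from an arbitrary initial vertex.
    Half-open parameter intervals count each vertex once, so the last but one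
    clause says that the boundary is a simple closed curve; for such a curve,
    positive signed area means counterclockwise traversal. *)
Definition circular_arc_polygon (es : list edge) : Prop :=
  es <> [] /\
  Forall wf_edge es /\
  (forall i e f,
     nth_error es i = Some e ->
     nth_error es ((i + 1) mod length es)%nat = Some f ->
     edge_point e 1 = edge_point f 0) /\
  (forall i j e f s t,
     nth_error es i = Some e -> nth_error es j = Some f ->
     0 <= s < 1 -> 0 <= t < 1 ->
     edge_point e s = edge_point f t -> i = j /\ s = t) /\
  0 < signed_area es.

Definition non_x_monotone (A : arc) : Prop :=
  exists (x0 : R) (P Q : point),
    on_arc A P /\ on_arc A Q /\ P <> Q /\ fst P = x0 /\ fst Q = x0.

Definition sub_arc (A : arc) (s t : R) : arc :=
  Arc_of (center A) (radius A)
         (start_angle A + s * sweep A) ((t - s) * sweep A).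

Fixpoint sub_arcs (A : arc) (ts : list R) : list arc :=
  match ts with
  | s :: ((t :: _) as ts') => sub_arc A s t :: sub_arcs A ts'
  | _ => []
  end.

(** [ts] lists the parameters of the points, other than the endpoints, at which
    [A] meets the horizontal line through its center. *)
Definition decomposition (A : arc) (ps : list arc) : Prop :=
  exists ts : list R,
    StronglySorted Rlt ts /\
    (forall t, In t ts <->
       0 < t < 1 /\ snd (arc_point A t) = snd (center A)) /\
    ps = sub_arcs A (0 :: ts ++ [1]).

Definition item : Type := (edge * nat)%type.

Definition tag (it : item) : nat := snd it.

(** [m] is the number of arcs decomposed earlier in the list, so the 1st, 3rd,
    5th, ... decomposed arc has [m] even. *)
Definition arc_tag (m : nat) : nat := if Nat.even m then 1%nat else 2%nat.

Definition is_decomposed (e : edge) : Prop :=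
  match e with
  | Seg _ _ => False
  | Arc A => non_x_monotone A
  end.

Inductive processed : nat -> list edge -> list item -> Prop :=
| processed_nil m : processed m [] []
| processed_keep m e es S :
    ~ is_decomposed e -> processed m es S ->
    processed m (e :: es) ((e, 0%nat) :: S)
| processed_split m A ps es S :
    non_x_monotone A -> decomposition A ps ->
    processed (m + 1) es S ->
    processed m (Arc A :: es) (map (fun p => (Arc p, arc_tag m)) ps ++ S).

Definition sequence_list (es : list edge) (related : edge -> bool)
    (S : list item) : Prop :=
  processed 0 (filter related es) S.

Definition maximal_run (S : list item) (g : nat) (run : list item) : Prop :=
  exists pre post,
    S = pre ++ run ++ post /\
    run <> [] /\
    Forall (fun it => tag it = g) run /\
    (forall pre' it, pre = pre' ++ [it] -> tag it <> g) /\
    (forall it post', post = it :: post' -> tag it <> g).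

(* Main.v *)
Require Import Defs.
From Stdlib Require Import Reals List Arith.
From Stdlib Require Import Lra Lia Sorted.
Import ListNotations.
Open Scope R_scope.

(** A non-x-monotone arc contains two points that are mirror images in the
    horizontal line through its center, so it crosses that line in its interior
    by the intermediate value theorem.  The crossings are zeros of the sine,
    spaced by [PI], in an open interval of length at most [2 * PI], so there
    are at most two.  Hence every decomposed arc yields two or three pieces.
    Tags of successive decomposed arcs differ, so a maximal run is exactly the
    set of pieces of one arc. *)

Lemma length_sub_arcs (A : arc) (s : R) (ts : list R) :
  length (sub_arcs A (s :: ts)) = length ts.
Proof.
  revert s; induction ts as [|t ts IH]; intros s; [reflexivity|].
  exact (f_equal Datatypes.S (IH t)).
Qed.

Lemma on_center_line_sin (A : arc) (t : R) :
  0 < radius A ->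
  snd (arc_point A t) = snd (center A) <-> sin (start_angle A + t * sweep A) = 0.
Proof.
  intros Hr; unfold arc_point; simpl; split; intros H.
  - apply (Rmult_eq_reg_l (radius A)); lra.
  - rewrite H; ring.
Qed.

(** Intermediate value theorem for the sine of the angle. Its values at both ends are nonzero, so
    the zero lies strictly inside, as [decomposition] requires of a cut. *)
Lemma crossing_between (A : arc) (s t : R) :
  s < t ->
  sin (start_angle A + s * sweep A) = - sin (start_angle A + t * sweep A) ->
  sin (start_angle A + t * sweep A) <> 0 ->
  exists u, s < u < t /\ sin (start_angle A + u * sweep A) = 0.
Proof.
  intros Hst Hopp Hnz.
  set (f := fun u => sin (start_angle A + u * sweep A)).
  assert (Hc : continuity f).
  { unfold f; intros u; apply derivable_continuous_pt; reg. }
  destruct (IVT_cor f s t Hc) as [u [Hu Hfu]].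
  - lra.
  - unfold f; rewrite Hopp; nra.
  - unfold f in Hfu; exists u; split; [|exact Hfu].
    split; apply Rnot_le_lt; intros Hle.
    + replace u with s in Hfu by lra; lra.
    + replace u with t in Hfu by lra; lra.
Qed.

Lemma non_x_monotone_crossing (A : arc) :
  0 < radius A -> non_x_monotone A ->
  exists u, 0 < u < 1 /\ snd (arc_point A u) = snd (center A).
Proof.
  intros Hr (x & P & Q & [s [Hs HP]] & [t [Ht HQ]] & Hne & Hx & Hy).
  enough (exists u, 0 < u < 1 /\ sin (start_angle A + u * sweep A) = 0)
    as [u [Hu H]].
  { exists u; split; [exact Hu | now apply on_center_line_sin]. }
  subst P Q; unfold arc_point in *; simpl in *.
  set (a := start_angle A + s * sweep A) in *.
  set (b := start_angle A + t * sweep A) in *.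
  assert (Hcos : cos a = cos b) by (apply (Rmult_eq_reg_l (radius A)); lra).
  assert (Hsin : sin a <> sin b) by (intros E; apply Hne; now rewrite E, Hcos).
  (* Equal cosines force equal squared sines. As the points are distinct, only the mirror image
     remains, and both sines are nonzero. *)
  assert (Hopp : sin a = - sin b).
  { pose proof (sin2_cos2 a) as Ha; pose proof (sin2_cos2 b) as Hb.
    rewrite Hcos in Ha; unfold Rsqr in Ha, Hb.
    assert (H : (sin a - sin b) * (sin a + sin b) = 0) by nra.
    apply Rmult_integral in H; lra. }
  destruct (Rtotal_order s t) as [Hst|[Hst|Hst]].
  - destruct (crossing_between A s t Hst) as [u [Hu Hz]];
      fold a b; [lra | lra |].
    exists u; split; [lra | exact Hz].
  - exfalso; apply Hsin; unfold a, b; now rewrite Hst.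
  - destruct (crossing_between A t s Hst) as [u [Hu Hz]];
      fold a b; [lra | lra |].
    exists u; split; [lra | exact Hz].
Qed.

Lemma at_most_two_crossings (A : arc) (t1 t2 t3 : R) :
  0 < Rabs (sweep A) <= 2 * PI ->
  0 < t1 -> t1 < t2 -> t2 < t3 -> t3 < 1 ->
  sin (start_angle A + t1 * sweep A) = 0 ->
  sin (start_angle A + t2 * sweep A) = 0 ->
  sin (start_angle A + t3 * sweep A) = 0 ->
  False.
Proof.
  intros [Hw0 Hw] H0 H12 H23 H1 Z1 Z2 Z3.
  pose proof PI_RGT_0 as Hpi.
  apply sin_eq_0_0 in Z1 as [k1 E1]; apply sin_eq_0_0 in Z2 as [k2 E2];
    apply sin_eq_0_0 in Z3 as [k3 E3].
  (* Zeros of the sine are integer multiples of [PI], so the angle between two crossings is one as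
     well. *)
  assert (D12 : (t2 - t1) * sweep A = IZR (k2 - k1) * PI)
    by (rewrite minus_IZR; lra).
  assert (D23 : (t3 - t2) * sweep A = IZR (k3 - k2) * PI)
    by (rewrite minus_IZR; lra).
  destruct (Rtotal_order (sweep A) 0) as [Hs|[Hs|Hs]].
  - rewrite Rabs_left in Hw by exact Hs.
    (* The sign of the sweep fixes the sign of these integers, and integrality sharpens it to a gap
       of at least [PI]. *)
    assert (K12 : (k2 - k1 < 0)%Z) by (apply lt_IZR; nra).
    assert (K23 : (k3 - k2 < 0)%Z) by (apply lt_IZR; nra).
    assert (IZR (k2 - k1) <= -1) by (apply IZR_le; lia).
    assert (IZR (k3 - k2) <= -1) by (apply IZR_le; lia).
    assert (2 * PI <= (t3 - t1) * - sweep A) by nra.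
    (* Since [t3 - t1 < 1], the angle spanned is strictly below [2 * PI], even on a whole circle. *)
    nra.
  - rewrite Hs, Rabs_R0 in Hw0; lra.
  - rewrite Rabs_right in Hw by lra.
    assert (K12 : (0 < k2 - k1)%Z) by (apply lt_IZR; nra).
    assert (K23 : (0 < k3 - k2)%Z) by (apply lt_IZR; nra).
    assert (1 <= IZR (k2 - k1)) by (apply IZR_le; lia).
    assert (1 <= IZR (k3 - k2)) by (apply IZR_le; lia).
    assert (2 * PI <= (t3 - t1) * sweep A) by nra.
    nra.
Qed.

Lemma decomposition_length (A : arc) (ps : list arc) :
  wf_arc A -> non_x_monotone A -> decomposition A ps ->
  (2 <= length ps <= 3)%nat.
Proof.
  intros [Hr Hw] Hnm (ts & Hsort & Hin & ->).
  (* With both endpoints added, [n] crossings cut the arc into [n + 1] pieces; it remains to show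
     that [n] is 1 or 2. *)
  rewrite length_sub_arcs, length_app; simpl.
  split.
  - destruct (non_x_monotone_crossing A Hr Hnm) as [u Hu].
    apply Hin in Hu; destruct ts; [destruct Hu | simpl; lia].
  - destruct ts as [|t1 [|t2 [|t3 ts]]]; simpl; try lia.
    destruct (proj1 (Hin t1)) as [B1 Z1]; [simpl; tauto|].
    destruct (proj1 (Hin t2)) as [B2 Z2]; [simpl; tauto|].
    destruct (proj1 (Hin t3)) as [B3 Z3]; [simpl; tauto|].
    apply on_center_line_sin in Z1, Z2, Z3; try exact Hr.
    inversion Hsort as [|? ? Hsort' F1]; subst.
    inversion Hsort' as [|? ? _ F2]; subst.
    apply Forall_inv in F1, F2.
    exfalso; apply (at_most_two_crossings A t1 t2 t3); trivial; lra.
Qed.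

Lemma arc_tag_neq_0 (m : nat) : arc_tag m <> 0%nat.
Proof. unfold arc_tag; destruct (Nat.even m); discriminate. Qed.

Lemma arc_tag_succ_neq (m : nat) : arc_tag (m + 1) <> arc_tag m.
Proof.
  unfold arc_tag; rewrite Nat.add_1_r, Nat.even_succ, <- Nat.negb_even.
  destruct (Nat.even m); discriminate.
Qed.

(** Used with counter [m + 1], it shows that the pieces tagged [arc_tag m] are not continued by the
    next item. *)
Lemma processed_head_tag (m : nat) (es : list edge) (it : item) (S : list item) :
  processed m es (it :: S) -> tag it = 0%nat \/ tag it = arc_tag m.
Proof.
  intros H; remember (it :: S) as L eqn:E.
  destruct H as [m|m e es S' _ _|m A ps es S' _ Hd _].
  - discriminate.
  - injection E as <- _; now left.
  - right.
    (* The cut list always contains 0 and 1, so there is at least one piece and the head item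
       belongs to this arc. *)
    destruct ps as [|p ps].
    + destruct Hd as (ts & _ & _ & E').
      apply (f_equal (@length arc)) in E'.
      rewrite length_sub_arcs, length_app in E'; simpl in E'; lia.
    + simpl in E; injection E as <- _; reflexivity.
Qed.

Lemma maximal_run_cons (x : item) (S : list item) (g : nat) (run : list item) :
  tag x <> g -> maximal_run (x :: S) g run -> maximal_run S g run.
Proof.
  intros Hx (pre & post & E & Hne & Hall & Hl & Hr).
  destruct pre as [|y pre].
  - destruct run as [|y run]; [now destruct Hne|].
    injection E as -> _; apply Forall_inv in Hall; contradiction.
  - injection E as <- ->.
    exists pre, post; repeat split; trivial.
    intros pre' it ->; now apply (Hl (x :: pre')).
Qed.

(** A run starting inside [B] has tag [a]; maximality then makes it begin with [B] and reach its
    end, and the tag following [B] stops it there. *)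
Lemma maximal_run_block (B S : list item) (a g : nat) (run : list item) :
  Forall (fun it => tag it = a) B ->
  (forall it S', S = it :: S' -> tag it <> a) ->
  maximal_run (B ++ S) g run -> run = B \/ maximal_run S g run.
Proof.
  intros HB HS (pre & post & E & Hne & Hall & Hl & Hr).
  (* The run starts either after [B], including right at its end, or at an item [x] of [B]. *)
  assert (Hcase : (exists l, pre = B ++ l /\ S = l ++ run ++ post) \/
                  (exists x l, B = pre ++ x :: l /\ run ++ post = x :: l ++ S)).
  { apply app_eq_app in E as [l [[E1 E2]|[E1 E2]]].
    - destruct l as [|x l].
      + left; exists []; rewrite app_nil_r in *; now subst.
      + right; now exists x, l.
    - left; now exists l. }
  destruct Hcase as [[l [-> ->]]|(x & l & EB & E')].
  - right; exists l, post; repeat split; trivial.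
    intros pre' it ->; apply (Hl (B ++ pre')); apply app_assoc.
  - left.
    assert (Hg : g = a).
    { destruct run as [|y run]; [now destruct Hne|].
      injection E' as -> _; apply Forall_inv in Hall.
      rewrite Forall_forall in HB; rewrite <- Hall; apply HB.
      rewrite EB; apply in_elt. }
    subst g.
    (* If [pre] is nonempty, its last item lies in [B] and would extend the run to the left. *)
    destruct pre as [|y pre _] using rev_ind.
    + simpl in E; apply app_eq_app in E as [k [[E1 E2]|[E1 E2]]].
      * destruct k as [|z k]; [now rewrite app_nil_r in E1|].
        exfalso; apply (Hr z (k ++ S) E2).
        rewrite Forall_forall in HB; apply HB; rewrite E1; apply in_elt.
      * destruct k as [|z k]; [now rewrite app_nil_r in E1|].
        exfalso; apply (HS z (k ++ post) E2).
        rewrite Forall_forall in Hall; apply Hall; rewrite E1; apply in_elt.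
    + exfalso; apply (Hl pre y eq_refl).
      rewrite Forall_forall in HB; apply HB; rewrite EB, <- app_assoc; apply in_elt.
Qed.

(** The counter [m] is arbitrary because each decomposed arc raises it for the rest of the list. *)
Lemma processed_run_length (m : nat) (es : list edge) (S : list item)
    (g : nat) (run : list item) :
  processed m es S -> Forall wf_edge es -> g <> 0%nat -> maximal_run S g run ->
  (2 <= length run <= 3)%nat.
Proof.
  intros Hp; revert run.
  induction Hp as [m|m e es S Hd Hp IH|m A ps es S Hnm Hd Hp IH];
    intros run Hwf Hg Hrun.
  - destruct Hrun as (pre & post & E & Hne & _).
    symmetry in E; apply app_eq_nil in E as [_ E]; apply app_eq_nil in E as [E _].
    contradiction.
  - apply IH; [exact (Forall_inv_tail Hwf) | exact Hg |].
    apply maximal_run_cons in Hrun; [exact Hrun | simpl; congruence].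
  - apply maximal_run_block with (a := arc_tag m) in Hrun as [->|Hrun].
    + rewrite length_map; apply (decomposition_length A); trivial.
      exact (Forall_inv Hwf).
    + apply IH; trivial; exact (Forall_inv_tail Hwf).
    + apply Forall_map, Forall_forall; reflexivity.
    + intros it S' ->.
      destruct (processed_head_tag _ _ _ _ Hp) as [->| ->].
      * apply not_eq_sym, arc_tag_neq_0.
      * apply arc_tag_succ_neq.
Qed.

Theorem theorem4 (es : list edge) (related : edge -> bool) (S : list item)
    (g : nat) (run : list item) (epsilon : nat) :
  circular_arc_polygon es ->
  sequence_list es related S ->
  g <> 0%nat ->
  maximal_run S g run ->
  epsilon = length run ->
  (2 <= epsilon <= 3)%nat.
Proof.
  intros (_ & Hwf & _) HS Hg Hrun ->.
  apply (processed_run_length 0 (filter related es) S g); trivial.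
  exact (incl_Forall (incl_filter related es) Hwf).
Qed.
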